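(* Let $(X,T)$ be a topological space and $A\subseteq X$. Then the following conditions are equivalent: (i) $A$ is compact in $(X,T)$. (ii) ${}^*A\subseteq\bigcup_{x\in A}\mu(x)$. (iii) $\bigcup_{x\in A}\mu(x)=\bigcup_{\alpha\in{}^*A}\mu(\alpha)$. (iv) $\bigcup_{x\in A}\mu(x)=\mu(A)$.
   Context: Nonstandard setting. Let $S\supseteq X\cup\mathbb R$ be a set of individuals, with superstructure $V(S)=\bigcup_{k\ge 0}V_k(S)$, $V_0(S)=S$, $V_{k+1}(S)=V_k(S)\cup\mathcal P(V_k(S))$. A $\kappa$-saturated nonstandard model of $S$ is a superstructure $V({}^*S)$ with a map $A\mapsto {}^*A$ from $V(S)$ into $V({}^*S)$ satisfying: (Extension) ${}^*s=s$ for all $s\in S$; (Transfer) a bounded quantifier formula $\Phi(A_1,\dots,A_n)$ with constants in $V(S)$ is true iff $\Phi({}^*A_1,\dots,{}^*A_n)$ is true in $V({}^*S)$; (Saturation) every family of at most $\kappa$ internal sets with the finite intersection property has nonempty intersection. An entity of $V({}^*S)$ is internal if it is an element of ${}^*A$ for some $A\in V(S)$. Throughout, a $\kappa$-saturated model with $\kappa$ infinite and $\kappa>\operatorname{card}T$ is fixed; $X\subseteq {}^*X$. Monads: for $\alpha\in{}^*X$, $\mu(\alpha)=\bigcap\{{}^*G:G\in T,\ \alpha\in{}^*G\}$. For $B\subseteq{}^*X$, $\mu(B)=\bigcap\{{}^*G:G\in T,\ B\subseteq{}^*G\}$. ''Compact'' means every open cover has a finite subcover (no Hausdorff requirement). 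*)

(* Defs.v *)
From mathcomp Require Import all_boot all_classical all_reals topology.

Set Implicit Arguments.
Unset Strict Implicit.
Unset Printing Implicit Defensive.

Local Open Scope classical_set_scope.
Local Open Scope card_scope.

(** * The superstructure V(S)

    Individuals are atoms: they have no members and are distinct from all sets.
    Since V_(k+1) = V_k U P(V_k), an induction gives V_(k+1) = S U P(V_k), and
    this is how [stage] presents the k-th level.  A set occurs in many stages,
    so the entities of V(S) = U_k V_k(S) are the elements of the stages modulo
    equality of sets ([same]).  The lemmas [level0], [levelS] and [level_cover]
    recover the defining equations of the superstructure. *)

Fixpoint stage (S : Type) (k : nat) : Type :=
  if k is k'.+1 then (S + set (stage S k'))%type else S.

Fixpoint same (S : Type) (j k : nat) {struct j} :
    stage S j -> stage S k -> Prop :=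
  match j, k return stage S j -> stage S k -> Prop with
  | 0, 0 => fun s t => s = t
  | 0, _.+1 => fun s y => y = inl s
  | _.+1, 0 => fun x t => x = inl t
  | _.+1, _.+1 => fun x y =>
      match x, y with
      | inl s, inl t => s = t
      | inr B, inr C => (forall b, B b -> exists2 c, C c & same b c) /\
                        (forall c, C c -> exists2 b, B b & same b c)
      | _, _ => False
      end
  end.

Definition code (S : Type) : Type := {k : nat & stage S k}.

Definition same_code (S : Type) (c : code S) : set (code S) :=
  [set d | same (projT2 c) (projT2 d)].

Record entity (S : Type) : Type := Entity {
  entity_class : set (code S);
  entity_classP : exists c, entity_class = same_code c }.

Definition entity_of (S : Type) (k : nat) (x : stage S k) : entity S :=
  @Entity S (same_code (existT _ k x)) (ex_intro _ _ erefl).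

Definition mem_ent (S : Type) (a b : entity S) : Prop :=
  exists (k : nat) (B : set (stage S k)) (x : stage S k),
    [/\ B x, a = entity_of x & b = @entity_of S k.+1 (inr B)].

Definition members (S : Type) (b : entity S) : set (entity S) :=
  [set a | mem_ent a b].

Definition indiv (S : Type) (s : S) : entity S := @entity_of S 0 s.

Definition is_set (S : Type) (b : entity S) : Prop := ~ range (@indiv S) b.

(** A subset of S, as an element of V_1(S). *)
Definition ent_set (S : Type) (A : set S) : entity S :=
  @entity_of S 1 (inr A).

Definition level (S : Type) (k : nat) : set (entity S) :=
  range (@entity_of S k).

Section SuperstructureTheory.
Variable S : Type.
Implicit Types (a b : entity S).

Lemma same_refl k (x : stage S k) : same x x.
Proof.
elim: k x => [//|k IH] [s//|B] /=.
by split=> b Bb; exists b.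
Qed.

Lemma same_sym j k (x : stage S j) (y : stage S k) : same x y -> same y x.
Proof.
elim: j k x y => [|j IH] [|k] x y //=.
case: x y => [s|B] [t|C] //= [BC CB]; split.
- by move=> c /CB[b Bb bc]; exists b => //; exact: IH.
- by move=> b /BC[c Cc bc]; exists c => //; exact: IH.
Qed.

Lemma same_trans j k l (x : stage S j) (y : stage S k) (z : stage S l) :
  same x y -> same y z -> same x z.
Proof.
elim: j k l x y z => [|j IH] [|k] [|l] x y z //=; try congruence.
- by move=> ->; case: z => // s <-.
- by move=> -> ->.
- by case: x => [s|B]; case: y => // t st [<-]; rewrite st.
case: x y z => [s|B] [t|C] [u|D] //=; first by move=> -> ->.
move=> [BC CB] [CD DC]; split.
- by move=> b /BC[c /CD[d Dd cd] bc]; exists d => //; exact: IH bc cd.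
- by move=> d /DC[c /CB[b Bb bc] cd]; exists b => //; exact: IH bc cd.
Qed.

Lemma same_eq k (x y : stage S k) : same x y -> x = y.
Proof.
elim: k x y => [//|k IH] [s|B] [t|C] //=; first by move=> ->.
move=> [BC CB]; congr inr; apply/seteqP; split.
- by move=> b /BC[c Cc /IH ->].
- by move=> c /CB[b Bb /IH <-].
Qed.

Lemma entity_eq a b : entity_class a = entity_class b -> a = b.
Proof.
by case: a b => [a pa] [b pb] /= ab; subst b; congr Entity; exact: Prop_irrelevance.
Qed.

Lemma entity_ofP j k (x : stage S j) (y : stage S k) :
  entity_of x = entity_of y <-> same x y.
Proof.
split=> [/(congr1 (@entity_class S)) xy|xy].
  have : same_code (existT _ k y) (existT _ k y) by exact: same_refl.
  by rewrite -[same_code (existT _ k y)]xy.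
apply: entity_eq; apply/seteqP; split=> -[l z] /=; rewrite /same_code /=.
  exact/same_trans/same_sym.
exact: same_trans.
Qed.

Lemma entity_of_inj k : injective (@entity_of S k).
Proof. by move=> x y /entity_ofP/same_eq. Qed.

Lemma indiv_inj : injective (@indiv S).
Proof. exact: (@entity_of_inj 0). Qed.

Lemma level_cover a : exists k, level k a.
Proof.
case: (entity_classP a) => -[k x] ax; exists k, x => //.
by apply: entity_eq; rewrite ax.
Qed.

Lemma indivE k (s : S) : indiv s = @entity_of S k.+1 (inl s).
Proof. exact/entity_ofP. Qed.

Lemma is_set_of k (B : set (stage S k)) : is_set (@entity_of S k.+1 (inr B)).
Proof. by move=> [s _ /entity_ofP]. Qed.

Lemma is_setP b :
  is_set b <-> exists k (B : set (stage S k)), b = @entity_of S k.+1 (inr B).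
Proof.
split=> [|[k [B ->]]]; last exact: is_set_of.
case: (level_cover b) => -[|k] /= [x _ <-]; first by case; exists x.
case: x => [s|B]; last by exists k, B.
by case; exists s => //; exact: indivE.
Qed.

Lemma members_indiv (s : S) : members (indiv s) = set0.
Proof. by apply/seteqP; split=> // a [k [B [x [_ _ /entity_ofP]]]]. Qed.

Lemma members_of k (B : set (stage S k)) :
  members (@entity_of S k.+1 (inr B)) = @entity_of S k @` B.
Proof.
apply/seteqP; split=> [a [j [C [x [Cx -> /entity_ofP[BC CB]]]]]|_ [x Bx <-]].
  by have [y By xy] := CB _ Cx; exists y => //; exact/entity_ofP.
by exists k, B, x.
Qed.

Lemma extensionality a b :
  is_set a -> is_set b -> members a = members b -> a = b.
Proof.
move=> /is_setP[j [B ->]] /is_setP[k [C ->]]; rewrite !members_of => BC.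
apply/entity_ofP; split=> x xP.
- have [y Cy yx] : (@entity_of S k @` C) (entity_of x) by rewrite -BC; exists x.
  by exists y => //; exact/same_sym/entity_ofP.
- have [y By yx] : (@entity_of S j @` B) (entity_of x) by rewrite BC; exists x.
  by exists y => //; exact/entity_ofP.
Qed.

Lemma comprehension k (P : set (entity S)) : P `<=` level k ->
  exists b, [/\ level k.+1 b, is_set b & members b = P].
Proof.
move=> Pk; exists (@entity_of S k.+1 (inr (@entity_of S k @^-1` P))).
split; [by exists (inr (@entity_of S k @^-1` P))|exact: is_set_of|].
rewrite members_of; apply/seteqP; split=> [_ [x Px <-] //|a Pa].
by have [x _ xa] := Pk _ Pa; exists x => //=; rewrite xa.
Qed.

Lemma level0 : level 0 = range (@indiv S).
Proof. by []. Qed.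

Lemma level_set k b :
  is_set b -> level k.+1 b <-> members b `<=` @level S k.
Proof.
move=> bset; split=> [[[s|B] _ bE]|bk].
- by case: bset; exists s; rewrite ?(indivE k).
- by rewrite -bE members_of => _ [x _ <-]; exists x.
- have [c [ck cset cE]] := comprehension bk.
  by rewrite -(extensionality cset bset cE).
Qed.

Lemma level_sub k : @level S k `<=` level k.+1.
Proof.
elim: k => [|k IH] _ [x _ <-].
  by exists (inl x) => //; rewrite -indivE.
case: x => [s|B]; first by exists (inl s) => //; rewrite -!indivE.
apply/level_set; first exact: is_set_of.
by rewrite members_of => _ [x _ <-]; apply: IH; exists x.
Qed.

Lemma levelS k : @level S k.+1 =
  level k `|` [set b | is_set b /\ members b `<=` level k].
Proof.
apply/seteqP; split=> [b bk|b [|[bset bk]]]; last 2 first.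
- exact: level_sub.
- exact/level_set.
have [[s _ <-]|bset] := pselect (range (@indiv S) b); last first.
  by right; split=> //; exact/level_set.
by left; case: k {bk} => [|k]; [exists s|exists (inl s); rewrite ?(indivE k)].
Qed.

Lemma members_ent_set (A : set S) : members (ent_set A) = @indiv S @` A.
Proof. exact: members_of. Qed.

End SuperstructureTheory.

(** * Bounded quantifier formulas

    Variables are de Bruijn indices; a bounded quantifier [BAll i p] or
    [BEx i p] ranges over the members of the value of variable [i] (outside the
    scope of the quantifier) and binds index 0 in [p].  The constants of a
    formula are the values of its free variables. *)

Inductive bformula : Type :=
  | BMem of nat & nat
  | BEq of nat & nat
  | BNot of bformula
  | BAnd of bformula & bformula
  | BOr of bformula & bformula
  | BImp of bformula & bformula
  | BAll of nat & bformula
  | BEx of nat & bformula.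

Definition push (E : Type) (x : E) (e : nat -> E) : nat -> E :=
  fun i => if i is i'.+1 then e i' else x.

Fixpoint holds (S : Type) (e : nat -> entity S) (p : bformula) : Prop :=
  match p with
  | BMem i j => mem_ent (e i) (e j)
  | BEq i j => e i = e j
  | BNot q => ~ holds e q
  | BAnd q r => holds e q /\ holds e r
  | BOr q r => holds e q \/ holds e r
  | BImp q r => holds e q -> holds e r
  | BAll i q => forall x, mem_ent x (e i) -> holds (push x e) q
  | BEx i q => exists x, mem_ent x (e i) /\ holds (push x e) q
  end.

(** * Nonstandard models

    The set of individuals of the nonstandard universe is a type [sS]; the
    inclusion of S in *S is the injection [std].  The field [star_base] says
    that *S, the image of the entity S, is the set of all individuals of
    V( *S). *)

Record nonstandard_model (S sS : Type) : Type := NonstandardModel {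
  star : entity S -> entity sS;
  std : S -> sS;
  std_inj : injective std;
  star_base : star (ent_set [set: S]) = ent_set [set: sS];
  extension : forall s : S, star (indiv s) = indiv (std s);
  transfer : forall (p : bformula) (e : nat -> entity S),
    holds e p <-> holds (star \o e) p }.

Definition internal (S sS : Type) (M : nonstandard_model S sS)
    (b : entity sS) : Prop :=
  exists a : entity S, mem_ent b (star M a).

Definition finite_intersection_property (S : Type) (F : set (entity S)) : Prop :=
  forall G : set (entity S), G `<=` F -> finite_set G ->
    \bigcap_(b in G) members b !=set0.

(** The cardinal is the one of the type [K]. *)
Definition saturated (K : Type) (S sS : Type)
    (M : nonstandard_model S sS) : Prop :=
  forall F : set (entity sS),
    (forall b, F b -> is_set b /\ internal M b) ->
    F #<= [set: K] ->
    finite_intersection_property F ->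
    \bigcap_(b in F) members b !=set0.

(** * Monads

    A space [X] is embedded in the individuals by [iX : X -> S]; subsets of *X
    are sets of entities of V( *S). *)

Section Monads.
Context (X : topologicalType) (S sS : Type).
Variables (iX : X -> S) (M : nonstandard_model S sS).

Definition star_set (A : set X) : set (entity sS) :=
  members (star M (ent_set (iX @` A))).

Definition std_point (x : X) : entity sS := indiv (std M (iX x)).

Definition monad (alpha : entity sS) : set (entity sS) :=
  \bigcap_(G in [set G : set X | open G /\ star_set G alpha]) star_set G.

Definition monad_set (B : set (entity sS)) : set (entity sS) :=
  \bigcap_(G in [set G : set X | open G /\ B `<=` star_set G]) star_set G.

End Monads.

(* Main.v *)
(** Everything rests on one consequence of saturation: if no finite part of a
    family of open sets covers A, then some point of *A avoids all the *G with
    G in the family.  A point outside every monad mu(x), x in A, produces such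
    a family, namely the open G whose extension *G misses that point.  Only
    families of the form *(A \ G) are needed, so that no cardinal arithmetic
    beyond card T <= kappa enters. *)

Require Import Defs.
From mathcomp Require Import all_boot all_classical all_reals topology.

Set Implicit Arguments.
Unset Strict Implicit.
Unset Printing Implicit Defensive.

Local Open Scope classical_set_scope.
Local Open Scope card_scope.

Lemma finite_sub_image (T U : Type) (f : T -> U) (D : set T) (H : set U) :
  finite_set H -> H `<=` f @` D ->
  exists E, [/\ E `<=` D, finite_set E & H `<=` f @` E].
Proof.
move=> finH HD.
(* Each [b] gets a set of at most one preimage rather than a point, because a [b] outside [H] need
   not have one. *)
have /choice[g gP] : forall b, exists P : set T,
    [/\ P `<=` D, finite_set P & H b -> (f @` P) b].
  move=> b; have [/HD[x Dx <-]|nHb] := pselect (H b); last by exists set0; split.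
  by exists [set x]; split=> [_ ->||_] //; exists x.
exists (\bigcup_(b in H) g b); split.
- by move=> x [b _]; case: (gP b) => gD _ _ /gD.
- by apply: bigcup_finite => // b _; case: (gP b).
- by move=> b Hb; case: (gP b) => _ _ /(_ Hb)[x gx <-]; exists x => //; exists b.
Qed.

Section StarSets.
Variables (S sS : Type) (M : nonstandard_model S sS).

Lemma star_mem (a b : entity S) :
  mem_ent a b <-> mem_ent (star M a) (star M b).
Proof. exact: (transfer M (BMem 0 1) (push a (fun=> b))). Qed.

Lemma star_subU (a b c : entity S) : members a `<=` members b `|` members c ->
  members (star M a) `<=` members (star M b) `|` members (star M c).
Proof.
(* Under the quantifier index 0 is the bound element, and [a], [b], [c] shift to 1, 2, 3. *)
have [abc _] := transfer M (BAll 0 (BOr (BMem 0 2) (BMem 0 3)))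
  (push a (push b (fun=> c))).
exact: abc.
Qed.

Lemma star_disjoint (a b : entity S) : members a `<=` ~` members b ->
  members (star M a) `<=` ~` members (star M b).
Proof.
have [ab _] := transfer M (BAll 0 (BNot (BMem 0 2))) (push a (fun=> b)).
exact: ab.
Qed.

(* Transfer of "B is not an individual"; this excludes that *B is an atom even
   when B is empty. *)
Lemma star_ent_set_is_set (B : set S) : is_set (star M (ent_set B)).
Proof.
move=> [s _ sB].
have : members (star M (ent_set [set: S])) (star M (ent_set B)).
  by rewrite star_base members_ent_set; exists s.
move/star_mem; rewrite -[mem_ent _ _]/(members (ent_set _) _) members_ent_set.
by case=> [t _ tB]; case: (@is_set_of S 0 B); exists t.
Qed.

Lemma star_ent_set_internal (B : set S) : internal M (star M (ent_set B)).
Proof.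
(* [P] is V_1(S) as an entity; every subset of S is one of its members. *)
have [P [_ _ PE]] := @comprehension S 1 (level 1) (@subset_refl _ _).
exists P; apply/star_mem; rewrite -[mem_ent _ _]/(members P _) PE.
by exists (inr B).
Qed.

End StarSets.

Section SpaceStar.
Context (X : topologicalType) (S sS : Type).
Variables (iX : X -> S) (iX_inj : injective iX) (M : nonstandard_model S sS).
Implicit Types (A B C G : set X) (E : set (set X)).

Local Notation star_set := (star_set iX M).
Local Notation std_point := (std_point iX M).
Local Notation monad := (monad iX M).

Lemma members_space_set A (a : entity S) :
  members (ent_set (iX @` A)) a <-> exists2 x, A x & a = indiv (iX x).
Proof.
rewrite members_ent_set; split=> [[_ [x Ax <-] <-]|[x Ax ->]]; first by exists x.
by exists (iX x) => //; exists x.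
Qed.

Lemma members_space_indiv A x :
  members (ent_set (iX @` A)) (indiv (iX x)) <-> A x.
Proof.
split=> [/members_space_set[y Ay xy]|Ax].
  by rewrite (iX_inj (indiv_inj xy)).
by apply/members_space_set; exists x.
Qed.

Lemma star_set_std A x : star_set A (std_point x) <-> A x.
Proof.
rewrite -(members_space_indiv A) /star_set /std_point -extension.
exact: iff_sym (star_mem M (indiv (iX x)) (ent_set (iX @` A))).
Qed.

Lemma star_set_subU A B C :
  A `<=` B `|` C -> star_set A `<=` star_set B `|` star_set C.
Proof.
move=> ABC; apply: star_subU => a /members_space_set[x /ABC[Bx|Cx] ->].
- by left; apply/members_space_indiv.
- by right; apply/members_space_indiv.
Qed.

Lemma star_setS A B : A `<=` B -> star_set A `<=` star_set B.
Proof.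
by move=> AB; rewrite -[star_set B]setUid; apply: star_set_subU; rewrite setUid.
Qed.

Lemma star_set_disjoint A B :
  A `<=` ~` B -> star_set A `<=` ~` star_set B.
Proof.
move=> AB; apply: star_disjoint => a /members_space_set[x /AB nBx ->].
by move=> /members_space_indiv.
Qed.

(** The empty set is disjoint from itself, and transfer preserves disjointness. *)
Lemma star_set0 alpha : ~ star_set set0 alpha.
Proof. by move=> a0; apply: (@star_set_disjoint set0 set0 _ _ a0). Qed.

(** Binary unions transfer, and induction along a list enumerating [E] iterates this; finiteness of
    subcovers enters here. *)
Lemma star_set_bigcup_finite E : finite_set E ->
  star_set (\bigcup_(G in E) G) `<=` \bigcup_(G in E) star_set G.
Proof.
move=> /finite_seqP[s ->]; rewrite !bigcup_seq; elim: s => [|G s IH] alpha.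
  by rewrite !big_nil => /star_set0.
by rewrite !big_cons => /(star_set_subU (@subset_refl _ _))[?|/IH]; [left|right].
Qed.

Lemma monad_refl alpha : monad alpha alpha.
Proof. by move=> G []. Qed.

(** Each [star_set G] with [G] open that contains [alpha] also contains [beta], so mu(beta)
    intersects at least as many sets as mu(alpha). *)
Lemma monad_trans alpha beta gamma :
  monad alpha beta -> monad beta gamma -> monad alpha gamma.
Proof. by move=> ab bc G [oG aG]; apply: bc; split=> //; apply: ab. Qed.

Lemma monad_stdP x alpha :
  monad (std_point x) alpha <-> (forall G, open G -> G x -> star_set G alpha).
Proof.
split=> [xa G oG Gx|xa G [oG /star_set_std]]; last exact: xa.
by apply: xa; split=> //; apply/star_set_std.
Qed.

Lemma not_monad_cover A alpha :
  ~ (\bigcup_(x in A) monad (std_point x)) alpha ->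
  A `<=` \bigcup_(G in [set G | open G /\ ~ star_set G alpha]) G.
Proof.
move=> nalpha x Ax; apply: contrapT => ncov; apply: nalpha; exists x => //.
apply/monad_stdP => G oG Gx; apply: contrapT => nGa.
by apply: ncov; exists G.
Qed.

(** The finitely many sets merge into one open set around [A] whose extension still misses [alpha],
    which is impossible for [alpha] in *A or in mu(A). *)
Lemma finite_cover_star A E alpha :
  finite_set E -> A `<=` \bigcup_(G in E) G ->
  E `<=` [set G | open G /\ ~ star_set G alpha] ->
  [/\ open (\bigcup_(G in E) G) & ~ star_set (\bigcup_(G in E) G) alpha].
Proof.
move=> finE AE Ealpha; split.
  by apply: bigcup_open => G /Ealpha[].
by move=> /(star_set_bigcup_finite finE)[G /Ealpha[]].
Qed.

Lemma saturated_avoid (K : Type) A (D : set (set X)) :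
  saturated K M -> [set G : set X | open G] #<= [set: K] ->
  D `<=` [set G | open G] ->
  (forall E, E `<=` D -> finite_set E -> ~ A `<=` \bigcup_(G in E) G) ->
  exists2 alpha, star_set A alpha & forall G, D G -> ~ star_set G alpha.
Proof.
move=> Msat TK Dopen ncov.
(* Adding the empty set to D makes the family nonempty, which forces the point
   into *A: an empty intersection would be the whole universe. *)
pose D0 := set0 |` D; pose F G := star M (ent_set (iX @` (A `\` G))).
have D0K : F @` D0 #<= [set: K].
  apply: card_le_trans (card_image_le F D0) _; apply: card_le_trans TK.
  by apply: subset_card_le => G [->|/Dopen //]; exact: open0.
have [b [G _ <-]||alpha alphaF] := Msat (F @` D0) _ D0K.
- by split; [exact: star_ent_set_is_set|exact: star_ent_set_internal].
(* Finite intersections contain a standard point: [E] without the added empty set is a finite part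
   of [D], so some [x] in [A] escapes its union. *)
- move=> H HF finH; have [E [ED finE HE]] := finite_sub_image finH HF.
  have /ncov : E `\ set0 `<=` D by move=> G [/ED[]].
  move=> /(_ (finite_setD _ finE))/existsNP[x /not_implyP[Ax nx]].
  exists (std_point x) => _ /HE[G EG <-].
  apply/star_set_std; split=> // Gx; apply: nx; exists G => //.
  by split=> // G0; rewrite G0 in Gx.
- have alphaD G : D0 G -> star_set (A `\` G) alpha.
    by move=> DG; apply: alphaF; exists G.
  exists alpha; first by apply: star_setS (alphaD set0 _); [exact: subDsetl|left].
  move=> G DG; apply: star_set_disjoint (alphaD G _); last by right.
  by move=> x [].
Qed.

(** A point of *A in no mu(x) would yield an open cover of [A] by sets whose extensions miss it; but
    the union of a finite subcover contains [A], so its extension contains the point. *)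
Lemma cover_compact_star_sub A : cover_compact A ->
  star_set A `<=` \bigcup_(x in A) monad (std_point x).
Proof.
move=> Acpt alpha Aalpha; apply: contrapT => nalpha.
have [|E ED AE] := Acpt _ _ id _ (not_monad_cover nalpha).
  by move=> G [].
have [G /ED/set_mem //|_] :=
  @finite_cover_star _ _ alpha (finite_fset E) AE.
by apply; apply: star_setS Aalpha.
Qed.

(** By [monad_trans], [alpha] in mu(x) forces mu(alpha) inside mu(x). *)
Lemma bigcup_monad_star A :
  star_set A `<=` \bigcup_(x in A) monad (std_point x) ->
  \bigcup_(x in A) monad (std_point x) =
    \bigcup_(alpha in star_set A) monad alpha.
Proof.
move=> Asub; apply/seteqP; split=> [beta [x Ax xb]|beta [alpha /Asub]].
  by exists (std_point x) => //; apply/star_set_std.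
by move=> [x Ax xa] ab; exists x => //; exact: monad_trans ab.
Qed.

Lemma bigcup_monad_sub_monad_set A :
  \bigcup_(x in A) monad (std_point x) `<=`
    monad_set iX M (std_point @` A).
Proof.
by move=> beta [x Ax xb] G [oG AG]; apply: xb; split=> //; apply: AG; exists x.
Qed.

Lemma star_set_sub_monad_set A : star_set A `<=` monad_set iX M (std_point @` A).
Proof.
move=> alpha Aalpha G [oG AG]; apply: star_setS Aalpha => x Ax.
by apply/star_set_std; apply: AG; exists x.
Qed.

(** If [beta] in mu(A) lay in no mu(x), the open sets whose extensions miss it would cover [A]
    without a finite subcover. Saturation then gives a point of *A avoiding all these extensions,
    yet it lies in some mu(x), hence in the extension of a covering set around x. *)
Lemma monad_set_sub_bigcup_monad (K : Type) A :
  saturated K M -> [set G : set X | open G] #<= [set: K] ->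
  star_set A `<=` \bigcup_(x in A) monad (std_point x) ->
  monad_set iX M (std_point @` A) `<=` \bigcup_(x in A) monad (std_point x).
Proof.
move=> Msat TK Asub beta Abeta; apply: contrapT => nbeta.
have cov := not_monad_cover nbeta.
have [||alpha Aalpha nalpha] := @saturated_avoid K A
    [set G | open G /\ ~ star_set G beta] Msat TK.
- by move=> G [].
- move=> E Ebeta finE AE.
  have [oE] := finite_cover_star finE AE Ebeta; apply; apply: Abeta.
  by split=> // _ [x /AE Ex <-]; apply/star_set_std.
- have [x Ax /monad_stdP xa] := Asub _ Aalpha.
  have [G [oG Gbeta] Gx] := cov _ Ax.
  by apply: (nalpha G) => //; apply: xa.
Qed.

(** The argument of [monad_set_sub_bigcup_monad], run on an arbitrary open cover without finite
    subcover. *)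
Lemma star_sub_cover_compact (K : Type) A :
  saturated K M -> [set G : set X | open G] #<= [set: K] ->
  star_set A `<=` \bigcup_(x in A) monad (std_point x) -> cover_compact A.
Proof.
move=> Msat TK Asub I D f fopen Acov; apply: contrapT => nfin.
have [||alpha Aalpha nalpha] := @saturated_avoid K A (f @` D) Msat TK.
- by move=> _ [i Di <-]; exact: fopen.
- move=> E ED finE AE; have [D0 [D0D finD0 ED0]] := finite_sub_image finE ED.
  have [D' D'E] := (finite_fsetP.1 finD0); apply: nfin; exists D'.
    by move=> i iD'; apply/mem_set/D0D; rewrite D'E.
  by move=> x /AE[_ /ED0[i D0i <-] fx]; exists i => //; rewrite -D'E.
- have [x Ax /monad_stdP xa] := Asub _ Aalpha.
  have [i Di fx] := Acov _ Ax.
  by apply: (nalpha (f i)); [exists i|apply: xa => //; exact: fopen].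
Qed.

End SpaceStar.

Theorem mainTheorem8 (R : realType) (X : topologicalType) (S sS K : Type)
  (iX : X -> S) (iR : R -> S) (iX_inj : injective iX) (iR_inj : injective iR)
  (M : nonstandard_model S sS)
  (K_infinite : infinite_set [set: K])
  (T_le_K : [set G : set X | open G] #<= [set: K])
  (K_nle_T : ~ ([set: K] #<= [set G : set X | open G]))
  (M_saturated : saturated K M)
  (A : set X) :
  [<-> cover_compact A;
       star_set iX M A `<=` \bigcup_(x in A) monad iX M (std_point iX M x);
       \bigcup_(x in A) monad iX M (std_point iX M x) =
         \bigcup_(alpha in star_set iX M A) monad iX M alpha;
       \bigcup_(x in A) monad iX M (std_point iX M x) =
         monad_set iX M (std_point iX M @` A)].
Proof.
tfae.
- exact: cover_compact_star_sub.
- exact: bigcup_monad_star.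
- move=> AE; apply/seteqP; split; first exact: bigcup_monad_sub_monad_set.
  apply: (monad_set_sub_bigcup_monad iX_inj M_saturated T_le_K).
  (* Since [alpha] lies in mu(alpha), (iii) gives back (ii). *)
  by rewrite AE => alpha Aalpha; exists alpha => //; exact: monad_refl.
- move=> AE; apply: (star_sub_cover_compact iX_inj M_saturated T_le_K).
  (* *A always lies in mu(A), so (iv) gives (ii). *)
  by rewrite AE; exact: star_set_sub_monad_set.
Qed.
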